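(* Let $f\colon X\rightarrow Y$ be a continuous surjection of compact Hausdorff spaces. If the induced map $f_*\colon\mathfrak{M}(X)\rightarrow\mathfrak{M}(Y)$, $\mu\mapsto\mu\circ f^{-1}$, is semi-open, then $f$ is semi-open.
   Context: For a compact Hausdorff space $Z$, $\mathfrak{M}(Z)$ denotes the set of all regular Borel probability measures on $Z$, equipped with the weak-$*$ topology. A continuous surjection $f\colon X\to Y$ of compact Hausdorff spaces induces a continuous surjection $f_*\colon\mathfrak{M}(X)\to\mathfrak{M}(Y)$, $\mu\mapsto\mu\circ f^{-1}$ (push-forward of measures). A continuous surjection $g\colon A\to B$ of topological spaces is semi-open if for every non-empty open subset $U$ of $A$, the interior of $g[U]$ in $B$ is non-empty. *)

(* Defs.v *)
From HB Require Import structures.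
From mathcomp Require Import all_boot all_order all_algebra.
From mathcomp Require Import all_classical all_reals all_analysis.

Set Implicit Arguments.
Unset Strict Implicit.
Unset Printing Implicit Defensive.
Import Order.TTheory GRing.Theory Num.Theory.
Import numFieldNormedType.Exports.
Local Open Scope classical_set_scope.
Local Open Scope ring_scope.

(* Measurable types are pointed, but compact Hausdorff spaces may be empty.
   Since an empty space carries no probability measure, the measurable space of
   Borel sets of [Z] is only formed under a proof [Z0] that [Z] is nonempty;
   proof irrelevance makes the choice of [Z0] immaterial. *)
Definition nonempty_copy (Z : topologicalType) (Z0 : [set: Z] !=set0) : Type :=
  Z.

HB.instance Definition _ (Z : topologicalType) (Z0 : [set: Z] !=set0) :=
  Choice.on (nonempty_copy Z0).
HB.instance Definition _ (Z : topologicalType) (Z0 : [set: Z] !=set0) :=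
  isPointed.Build (nonempty_copy Z0) (projT1 (cid Z0)).

Notation borel_space Z0 :=
  (g_sigma_algebraType (open : set (set (nonempty_copy Z0)))).

Notation borel := <<s open >>.

Definition regular_measure (R : realType) (Z : topologicalType)
    (mu : set Z -> \bar R) : Prop :=
  forall A : set Z, borel A ->
    mu A = ereal_inf [set mu U | U in [set U | open U /\ A `<=` U]] /\
    mu A = ereal_sup [set mu K | K in [set K | compact K /\ K `<=` A]].

(* Measures are total functions on [set Z]. They are required to vanish off the
   Borel sets, so that two elements of [regprob R Z] are equal as soon as they
   agree on Borel sets. *)
Record regprob (R : realType) (Z : topologicalType) := RegProb {
  regprob_nonempty : [set: Z] !=set0 ;
  regprob_measure :> probability (borel_space regprob_nonempty) R ;
  regprob_regular : regular_measure (regprob_measure : set Z -> \bar R) ;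
  regprob_nonborel : forall A : set Z, ~ borel A -> regprob_measure A = 0%E
}.

HB.instance Definition _ (R : realType) (Z : topologicalType) :=
  gen_eqMixin (regprob R Z).
HB.instance Definition _ (R : realType) (Z : topologicalType) :=
  gen_choiceMixin (regprob R Z).

Definition regprob_integral (R : realType) (Z : topologicalType)
    (mu : regprob R Z) : {ptws continuousType Z R -> R} :=
  fun phi => \int[mu]_x (phi : Z -> R) x.

(* The weak-* topology: the coarsest one making every map
   [mu |-> \int[mu]_x phi x], with [phi] continuous, continuous. *)
HB.instance Definition _ (R : realType) (Z : topologicalType) :=
  Topological.copy (regprob R Z) (initial_topology (@regprob_integral R Z)).

Definition semi_open (A B : topologicalType) (g : A -> B) : Prop :=
  forall U : set A, open U -> U !=set0 -> (g @` U)° !=set0.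

Lemma regprob_ext (R : realType) (Z : topologicalType) (mu nu : regprob R Z) :
  (forall A : set Z, borel A -> mu A = nu A) -> mu = nu.
Proof.
case: mu nu => [Z0 mu rmu nmu] [Z0' nu rnu nnu] /= munu.
have eZ := Prop_irrelevance Z0 Z0'; subst Z0'.
have {munu}emn : (mu : set Z -> \bar R) = nu.
  apply/funext => A; have [bA|bA] := pselect (borel A); first exact: munu.
  by rewrite nmu// nnu.
have {}emn : mu = nu.
  case: mu nu emn {rmu nmu rnu nnu} => [mu cmu] [nu cnu] /= emn.
  subst nu; congr Probability.Pack.
  case: cmu cnu => [[a1 a2] [b] [c] [d] [e] [g] [h]].
  case=> [[a1' a2'] [b'] [c'] [d'] [e'] [g'] [h']].
  rewrite (Prop_irrelevance a1' a1) (Prop_irrelevance a2' a2).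
  rewrite (Prop_irrelevance c' c) (Prop_irrelevance d' d).
  rewrite (Prop_irrelevance e' e) (Prop_irrelevance g' g).
  by rewrite (Prop_irrelevance h' h) (Prop_irrelevance b' b).
subst nu.
by rewrite (Prop_irrelevance rnu rmu) (Prop_irrelevance nnu nmu).
Qed.

Lemma borel_preimage (X Y : topologicalType) (f : X -> Y) (B : set Y) :
  continuous f -> borel B -> borel (f @^-1` B).
Proof.
move=> /continuousP cf; move: B; apply: smallest_sub; last first.
  by move=> U oU; apply: sub_sigma_algebra; exact: cf.
split=> /=.
- by rewrite preimage_set0; exact: sigma_algebra0.
- by move=> A bA; rewrite setTD preimage_setC -setTD; exact: sigma_algebraCD.
- by move=> F bF; rewrite preimage_bigcup; exact: sigma_algebra_bigcup.
Qed.

Section pushforward.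
Variables (R : realType) (X Y : topologicalType) (f : X -> Y).
Hypothesis hY : hausdorff_space Y.
Hypothesis cf : continuous f.
Variable mu : regprob R X.

Lemma pushforward_nonempty : [set: Y] !=set0.
Proof. by have [x _] := regprob_nonempty mu; exists (f x). Qed.

Let Yb := borel_space pushforward_nonempty.

Definition borel_pushforward : set Yb -> \bar R :=
  fun B => if `[< borel (B : set Y) >] then mu (f @^-1` B) else 0%E.

Local Notation nu := borel_pushforward.

Lemma borel_pushforwardE (B : set Y) : borel B -> nu B = mu (f @^-1` B).
Proof. by move=> bB; rewrite /nu asboolT. Qed.

Let nu0 : nu set0 = 0%E.
Proof.
rewrite borel_pushforwardE ?preimage_set0 ?measure0//; exact: sigma_algebra0.
Qed.

Let nu_ge0 B : (0 <= nu B)%E.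
Proof. by rewrite /nu; case: ifP => // _; exact: measure_ge0. Qed.

Let nu_sigma_additive : semi_sigma_additive nu.
Proof.
move=> F mF tF mUF; rewrite borel_pushforwardE// preimage_bigcup.
rewrite (_ : (fun n => _) =
    (fun n => \sum_(0 <= i < n) mu (f @^-1` F i))%E); last first.
  apply/funext => n; apply: eq_bigr => i _.
  by rewrite borel_pushforwardE//; exact: mF.
apply: measure_semi_sigma_additive.
- by move=> n; exact: borel_preimage (mF n).
- apply/trivIsetP => /= i j _ _ ij; rewrite -preimage_setI.
  by move/trivIsetP : tF => /(_ _ _ _ _ ij) ->//; rewrite preimage_set0.
- by rewrite -preimage_bigcup; exact: borel_preimage mUF.
Qed.

HB.instance Definition _ := isMeasure.Build _ Yb R nu nu0 nu_ge0
  nu_sigma_additive.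

Let nuT : nu setT = 1%E.
Proof.
rewrite borel_pushforwardE; last exact: (@measurableT _ Yb).
by rewrite preimage_setT probability_setT.
Qed.

HB.instance Definition _ := Measure_isProbability.Build _ Yb R nu nuT.

Let borel_open (U : set Y) : open U -> borel U.
Proof. exact: sub_sigma_algebra. Qed.

Let borel_compact (K : set Y) : compact K -> borel K.
Proof.
move=> /(compact_closed hY)/closed_openC/borel_open bK.
by rewrite -[K]setCK; exact: (@measurableC _ Yb).
Qed.

Let nu_le (A B : set Y) : borel A -> borel B -> A `<=` B -> (nu A <= nu B)%E.
Proof. by move=> bA bB; apply: (@le_measure _ R Yb nu); rewrite inE. Qed.

Let nu_inner (A : set Y) : borel A ->
  nu A = ereal_sup [set nu K | K in [set K | compact K /\ K `<=` A]].
Proof.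
move=> bA; apply/eqP; rewrite eq_le; apply/andP; split; last first.
  by apply: ge_ereal_sup => _ [K [cK KA] <-]; apply: nu_le; auto.
rewrite {1}borel_pushforwardE//.
have [_ ->] := regprob_regular mu (borel_preimage cf bA).
apply: ge_ereal_sup => _ [K [cK KA] <-].
have cfK : compact (f @` K).
  by apply: continuous_compact => //; exact: continuous_subspaceT.
have bfK := borel_compact cfK.
apply: (@le_trans _ _ (nu (f @` K))); last first.
  by apply: ereal_sup_ubound; exists (f @` K) => //; split=> // _ [x /KA ? <-].
rewrite borel_pushforwardE// (regprob_regular mu (borel_preimage cf bfK)).2.
by apply: ereal_sup_ubound; exists K => //; split=> // x Kx; exists x.
Qed.

Let nu_outer (A : set Y) : borel A ->
  nu A = ereal_inf [set nu U | U in [set U | open U /\ A `<=` U]].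
Proof.
move=> bA; set I := ereal_inf _.
have bCA : borel (~` A) by exact: (@measurableC _ Yb).
have fnu (B : set Y) : borel B -> nu B \is a fin_num.
  by move=> bB; exact: (@fin_num_measure _ Yb R nu).
have nuC (B : set Y) : borel B -> nu (~` B) = (1 - nu B)%E.
  by move=> bB; exact: (@probability_setC _ Yb R nu).
apply/eqP; rewrite eq_le; apply/andP; split.
  by apply: le_ereal_inf_tmp => _ [U [oU AU] <-]; apply: nu_le; auto.
have I0 : (0 <= I)%E by apply: le_ereal_inf_tmp => _ [U _ <-].
have I1 : (I <= 1)%E.
  by rewrite -nuT; apply: ereal_inf_lbound; exists setT => //; split=> //; exact: openT.
have fI : I \is a fin_num.
  by rewrite ge0_fin_numE// (le_lt_trans I1)// ltry.
suff : (nu (~` A) <= 1 - I)%E.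
  rewrite nuC//; move: (fnu _ bA) fI.
  case: (nu A) => // a _; case: (I) => // i _.
  by rewrite -!EFinB !lee_fin lerD2l lerN2.
rewrite nu_inner//; apply: ge_ereal_sup => _ [K [cK KA] <-].
have bK := borel_compact cK.
have : (I <= nu (~` K))%E.
  apply: ereal_inf_lbound; exists (~` K) => //; split.
    by apply: closed_openC; exact: compact_closed.
  by move=> x Ax /KA.
rewrite nuC//; move: (fnu _ bK) fI.
case: (nu K) => // a _; case: (I) => // i _.
by rewrite -!EFinB !lee_fin => ?; rewrite lerBrDr addrC -lerBrDr.
Qed.

Let nu_regular : regular_measure (nu : set Y -> \bar R).
Proof. by move=> A bA; split; [exact: nu_outer|exact: nu_inner]. Qed.

Let nu_nonborel (A : set Y) : ~ borel A -> nu A = 0%E.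
Proof. by move=> bA; rewrite /nu asboolF. Qed.

Definition pushforward_regprob : regprob R Y :=
  @RegProb R Y pushforward_nonempty nu nu_regular nu_nonborel.

End pushforward.

Lemma pushforward_regprobE (R : realType) (X Y : topologicalType) (f : X -> Y)
    (hY : hausdorff_space Y) (cf : continuous f) (mu : regprob R X) (B : set Y) :
  borel B -> pushforward_regprob hY cf mu B = mu (f @^-1` B).
Proof. exact: borel_pushforwardE. Qed.

(* Main.v *)
(** Let [U] be open with a point [x0], and let [phi : X -> [0, 1]] be an Urysohn
    function with [phi x0 = 1] that vanishes off [U]. The set [W] of measures
    with [\int phi > 1/2] is open and contains the Dirac measure at [x0], so its
    image under the push-forward has an interior point. Put
    [K = {phi >= 1/2}], a compact subset of [U]. If [f @` K] had empty
    interior, the finitely supported measures that give [f @` K] mass [0] would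
    be weak-* dense: partition [Y] into finitely many small Borel pieces and
    move the mass of each piece to a nearby point off [f @` K]. So some [mu] in
    [W] would push forward to such a measure, hence [mu K = 0] and
    [\int phi dmu <= 1/2], a contradiction. *)
Require Import Defs.
From HB Require Import structures.
From mathcomp Require Import all_boot all_order all_algebra.
From mathcomp Require Import all_classical all_reals all_analysis.
From mathcomp Require Import measurable_realfun.
Import Order.TTheory GRing.Theory Num.Theory.
Import numFieldNormedType.Exports.
Local Open Scope classical_set_scope.
Local Open Scope ring_scope.

(** * Finitely supported measures as regular measures *)

Section finite_support.
Context {R : realType} {Z : topologicalType} {Z0 : [set: Z] !=set0}.
Variable m : probability (borel_space Z0) R.

Local Notation Zb := (borel_space Z0).

(** [regprob] demands the value 0 off the Borel sets, where [m] itself may be arbitrary. *)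
Definition borel_restriction : set Zb -> \bar R :=
  fun B => if `[< borel (B : set Z) >] then m B else 0%E.

Local Notation m' := borel_restriction.

Lemma borel_restrictionE (B : set Z) : borel B -> m' B = m B.
Proof. by move=> bB; rewrite /m' asboolT. Qed.

Let m'0 : m' set0 = 0%E.
Proof. by rewrite borel_restrictionE ?measure0//; exact: sigma_algebra0. Qed.

Let m'_ge0 B : (0 <= m' B)%E.
Proof. by rewrite /m'; case: ifP => // _; exact: measure_ge0. Qed.

Let m'_sigma_additive : semi_sigma_additive m'.
Proof.
move=> F mF tF mUF; rewrite borel_restrictionE//.
rewrite (_ : (fun n => _) = (fun n => \sum_(0 <= i < n) m (F i))%E).
  exact: measure_semi_sigma_additive.
by apply/funext => n; apply: eq_bigr => i _; exact: borel_restrictionE (mF i).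
Qed.

HB.instance Definition _ := isMeasure.Build _ Zb R m' m'0 m'_ge0
  m'_sigma_additive.

Let m'T : m' setT = 1%E.
Proof.
by rewrite borel_restrictionE ?probability_setT//; exact: (@measurableT _ Zb).
Qed.

HB.instance Definition _ := Measure_isProbability.Build _ Zb R m' m'T.

(** Finite sets are closed and compact, so a Borel set [A] lies between the compact set [A &]
    S[and the open set]~[(S]\[A)]. Both differ from [A] only off [S], by a null set, so the supremum
    and the infimum are attained there. *)
Lemma finite_support_regprob (S : set Z) : hausdorff_space Z ->
  finite_set S -> m (~` S) = 0%E ->
  exists mu : regprob R Z, forall A : set Z, borel A -> mu A = m A.
Proof.
move=> hZ finS mS0.
have closed_fin (A : set Z) : finite_set A -> closed A.
  by move: A; apply/accessible_finite_set_closed; exact: hausdorff_accessible.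
have open_borel (A : set Z) : open A -> borel A by exact: sub_sigma_algebra.
have fin_borel (A : set Z) : finite_set A -> borel A.
  move=> /closed_fin/closed_openC/open_borel bA.
  by rewrite -[A]setCK; exact: (@measurableC _ Zb).
have bSC : borel (~` S) by exact: open_borel (closed_openC (closed_fin _ finS)).
have le_m (A B : set Z) : borel A -> borel B -> A `<=` B -> (m A <= m B)%E.
  by move=> bA bB; apply: (@le_measure _ R Zb m); rewrite inE.
have m_le (A B : set Z) :
    borel A -> borel B -> A `&` S `<=` B -> (m A <= m B)%E.
  move=> bA bB AB; rewrite -[leRHS]adde0 -mS0.
  apply: (@le_trans _ _ (m (B `|` ~` S))).
    apply: le_m => //; first exact: (@measurableU _ Zb).
    by move=> x Ax; have [Sx|Sx] := pselect (S x); [left; apply: AB|right].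
  exact: (@measureU2 _ Zb).
have regular_m' : regular_measure (m' : set Z -> \bar R).
  move=> A bA; split; apply/eqP; rewrite eq_le; apply/andP; split.
  - apply: le_ereal_inf_tmp => _ [U [oU AU] <-].
    by rewrite !borel_restrictionE ?le_m//; exact: open_borel.
  - have oU : open (~` (S `\` A)).
      by apply: closed_openC; apply: closed_fin; exact: finite_setD.
    apply: (@le_trans _ _ (m' (~` (S `\` A)))).
      apply: ereal_inf_lbound; exists (~` (S `\` A)) => //; split => //.
      by move=> x Ax [].
    rewrite !borel_restrictionE//; last exact: open_borel.
    apply: m_le => //; first exact: open_borel.
    by move=> x [nSA Sx]; apply: contrapT => nAx; exact: nSA.
  - have finAS : finite_set (A `&` S) by exact: finite_setIr.
    apply: (@le_trans _ _ (m' (A `&` S))).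
      by rewrite !borel_restrictionE ?m_le//; exact: fin_borel.
    apply: ereal_sup_ubound; exists (A `&` S) => //; split => //.
    exact: finite_compact.
  - apply: ge_ereal_sup => _ [K [cK KA] <-].
    have bK : borel K.
      rewrite -[K]setCK; apply: (@measurableC _ Zb); apply: open_borel.
      by apply: closed_openC; exact: compact_closed.
    by rewrite !borel_restrictionE// le_m.
have m'_nonborel (A : set Z) : ~ borel A -> m' A = 0%E.
  by move=> bA; rewrite /m' asboolF.
exists (@RegProb R Z Z0 m' regular_m' m'_nonborel) => A.
exact: borel_restrictionE.
Qed.

End finite_support.

(** * Weak-* convergence and integrals of continuous functions *)

Lemma cvg_initial_topology {S : choiceType} {T : topologicalType} (h : S -> T)
    (F : set_system S) (s : S) :
  Filter F -> h @ F --> h s -> F --> (s : initial_topology h).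
Proof.
move=> FF hFs A [_ [[B oB <-] Bs] BA].
by apply: (filterS BA); apply: hFs; exact: open_nbhs_nbhs.
Qed.

(** The pointwise topology is the supremum of the initial topologies of the evaluations. With
    [cvg_initial_topology], weak-* convergence reduces to convergence of each integral. *)
Lemma cvg_ptws {I : Type} {T : topologicalType} (F : set_system {ptws I -> T})
    (h : {ptws I -> T}) :
  Filter F -> (forall i, g i @[g --> F] --> h i) -> F --> h.
Proof.
by move=> FF Fh; apply/cvg_sup => i; apply: cvg_initial_topology; exact: Fh.
Qed.

Lemma measurable_fun_borel_continuous {R : realType} {Z : topologicalType}
    (Z0 : [set: Z] !=set0) (phi : Z -> R) :
  continuous phi -> measurable_fun [set: borel_space Z0] phi.
Proof.
move=> /continuousP cphi; apply: (measurability _ (RGenOpens.measurableE R)).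
move=> _ [_ [a [b ->] <-]]; rewrite setTI.
by apply: sub_sigma_algebra; apply: cphi; exact: interval_open.
Qed.

Lemma continuous_compact_bounded {R : realType} {Z : topologicalType}
    (phi : Z -> R) :
  compact [set: Z] -> continuous phi -> exists M, forall x, `|phi x| <= M.
Proof.
move=> cZ cphi; have : compact (phi @` setT).
  by apply: continuous_compact => //; exact: continuous_subspaceT.
move=> /compact_bounded[M [_ phiM]]; exists (M + 1) => x.
by apply: phiM; [rewrite ltrDl|exists x].
Qed.

Lemma bounded_integrable d (T : measurableType d) (R : realType)
    (P : probability T R) (phi : T -> R) (M : R) :
  measurable_fun setT phi -> (forall x, `|phi x| <= M) ->
  P.-integrable setT (EFin \o phi).
Proof.
move=> mphi phiM; apply: measurable_bounded_integrable => //.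
  by rewrite [ltLHS](_ : _ = 1%E) ?ltry//; exact: (probability_setT P).
exists M; split; first exact: num_real.
by move=> N MN x _; rewrite /= (le_trans (phiM x))// ltW.
Qed.

(** * Density of the measures that are null on a Borel set with empty interior *)

(** Finitely many open sets on which every [psi] in [D] varies little cover [Y]. The map [s] sends
    the piece belonging to each of them to one nearby point off [F]. *)
Lemma ex_finite_range_approximation {R : realType} {Y : topologicalType}
    (Y0 : [set: Y] !=set0) (F : set Y) (D : seq (continuousType Y R)) (e : R) :
  compact [set: Y] -> F° = set0 -> 0 < e ->
  exists s : {mfun borel_space Y0 >-> borel_space Y0},
    [/\ finite_set (range s),
        forall y, ~ F (s y) &
        forall psi, psi \in D -> forall y, `|psi (s y) - psi y| <= e].
Proof.
move=> cY F0 e0.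
(* Half of [e], since [psi z] and [psi (s z)] are to be compared through [psi y]. *)
pose O (y : Y) : set Y :=
  [set z | forall psi, psi \in D -> `|psi z - psi y| < e / 2].
have nbhsO y : nbhs y (O y).
  rewrite /O; elim: D {O} => [|psi D IH]; first exact: filterE.
  have : \forall z \near y, `|psi z - psi y| < e / 2.
    have /cvgrPdist_lt/(_ (e / 2)) := @cts_fun _ _ psi y.
    by rewrite divr_gt0// => /(_ isT); apply: filterS => z; rewrite distrC.
  move: IH; apply: filterS2 => z Dz psiz chi.
  by rewrite inE => /predU1P[->//|]; exact: Dz.
(* Otherwise [F] would contain the neighbourhood [O y] of [y]. *)
have /choice[p /all_and2[Op Fp]] : forall y, exists z, O y z /\ ~ F z.
  move=> y; apply: contrapT => nO.
  have : F° y; last by rewrite F0.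
  apply: filterS (nbhsO y) => z Oz; apply: contrapT => Fz; apply: nO.
  by exists z.
have [l lO] : exists l : seq Y, forall z, exists2 y, y \in l & (O y)° z.
  (* The finite subcover comes from the near-covering form of compactness, applied to the filter of
     lists ordered by inclusion. *)
  pose G := filter_from setT
    (fun l : seq Y => [set l' : seq Y | {subset l <= l'}]).
  have GG : ProperFilter G.
    apply: filter_from_proper; last by move=> l _; exists l => /=.
    apply: filter_fromT_filter; first by exists [::].
    move=> l1 l2; exists (l1 ++ l2) => l ll; split=> y yl; apply: ll;
      by rewrite mem_cat yl ?orbT.
  have near_cover : \forall l \near G,
      [set: Y] `<=` (fun z => exists2 y, y \in l & (O y)° z).
    move/compact_near_coveringP : cY; apply => y _.
    exists ((O y)°, [set l : seq Y | y \in l]) => /=.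
      split; first exact: nbhs_interior.
      by exists [:: y] => // l; apply; rewrite mem_head.
    by move=> [z l] /= [Oz yl]; exists y.
  by have [l lO] := filter_ex near_cover; exists l => z; exact: lO.
have [y0 _] := Y0.
(* The first [y] in [l] whose open set contains [z] decides, which makes the cover a partition. The
   default [p y0] is also off [F], and is never reached when [l] covers [Y]. *)
pose s (l : seq Y) (z : Y) : Y :=
  foldr (fun y w => if `[< (O y)° z >] then p y else w) (p y0) l.
have bO y : borel (O y)°.
  by apply: sub_sigma_algebra; exact: open_interior.
have ms k : measurable_fun [set: borel_space Y0]
    (s k : borel_space Y0 -> borel_space Y0).
  elim: k => [|y k IH]; first exact: (measurable_cst (p y0 : borel_space Y0)).
  apply: (@measurable_fun_ifT _ _ (borel_space Y0) (borel_space Y0)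
    (cst (p y)) (s k) (fun z => `[< (O y)° z >])) => //.
  apply: (measurable_fun_bool true); rewrite setTI.
  rewrite (_ : _ @^-1` _ = (O y)°); first exact: bO.
  by apply/seteqP; split => z /=; [move=> /asboolP|move=> /asboolP].
have sP k z : exists2 y, s k z = p y & y \in y0 :: k.
  elim: k => [|y k [y' sy' yk]] /=; first by exists y0; rewrite ?mem_head.
  case: ifPn => _; first by exists y; rewrite ?inE ?eqxx ?orbT.
  exists y' => //; move: yk; rewrite !inE => /orP[->//|->].
  by rewrite !orbT.
have sO k z :
    (exists2 y, y \in k & (O y)° z) -> exists2 y, s k z = p y & O y z.
  elim: k => [|y k IH] [y' //]; rewrite inE => y'k Oz /=.
  case: asboolP => [Oyz|nOyz].
    by exists y => //; exact: interior_subset Oyz.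
  apply: IH; exists y' => //; case/predU1P: y'k => // yy.
  by rewrite -yy in nOyz.
have [sl slE] : exists sl : {mfun borel_space Y0 >-> borel_space Y0},
    (sl : Y -> Y) = s l.
  by exists (mfun_Sub (mem_set (ms l))).
exists sl; rewrite slE; split => //.
- apply: (@sub_finite_set _ _ [set` map p (y0 :: l)]); last exact: finite_seq.
  by move=> _ [z _ <-]; have [y -> yl] := sP l z; exact: map_f.
- by move=> z; have [y -> _] := sP l z.
- move=> psi Dpsi z; have [y -> Oyz] := sO l z (lO z).
  rewrite -(subrK (psi y) (psi (p y))) -addrA (le_trans (ler_normD _ _))//.
  rewrite [leRHS]splitr lerD// ltW//; first exact: Op.
  by rewrite distrC; exact: Oyz.
Qed.

(** Here [mu] carries its own proof of nonemptiness; proof irrelevance identifies its Borel space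
    with that of [m]. *)
Lemma eq_regprob_integral {R : realType} {Z : topologicalType}
    {Z0 : [set: Z] !=set0} (m : probability (borel_space Z0) R)
    (mu : regprob R Z) (phi : Z -> R) :
  (forall A : set Z, borel A -> mu A = m A) ->
  \int[mu]_x phi x = \int[m]_x phi x.
Proof.
case: mu => [Z0' mu rmu nmu] /=.
have eZ := Prop_irrelevance Z0' Z0; subst Z0' => mum.
by rewrite /Rintegral (eq_measure_integral m)// => A mA _; exact: mum.
Qed.

(** Pushing [nu0] forward along a finite-range map that avoids [F] gives a measure null on [F] whose
    integrals of finitely many test functions are as close as desired. *)
Lemma finite_support_null_dense {R : realType} {Y : topologicalType}
    (F : set Y) (nu0 : regprob R Y) (N : set (regprob R Y)) :
  compact [set: Y] -> hausdorff_space Y -> borel F -> F° = set0 ->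
  nbhs nu0 N -> exists2 nu, N nu & nu F = 0%E.
Proof.
move=> cY hY bF F0 Nnu0.
(* These sets generate a filter that converges to [nu0] and lives on the measures null on [F]; its
   properness is the density. *)
pose near_nu0 (De : seq (continuousType Y R) * R) : set (regprob R Y) :=
  [set nu : regprob R Y | nu F = 0%E /\ forall psi, psi \in De.1 ->
     `|\int[nu0]_y (psi : Y -> R) y - \int[nu]_y (psi : Y -> R) y| <= De.2].
pose G := filter_from [set De | 0 < De.2] near_nu0.
have GG : ProperFilter G.
  apply: filter_from_proper => [|[D e] /= e0].
    apply: filter_from_filter; first by exists ([::], 1) => /=.
    move=> [D1 e1] [D2 e2] /= e10 e20; exists (D1 ++ D2, Num.min e1 e2) => /=.
      by rewrite lt_min e10.
    move=> nu [nuF nuD]; split; split=> //= psi psiD.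
      by apply: (le_trans (nuD psi _)); rewrite /= ?mem_cat ?psiD ?ge_min ?lexx.
    apply: (le_trans (nuD psi _)).
      by rewrite /= mem_cat psiD orbT.
    by rewrite /= ge_min lexx orbT.
  have [s [fins sF sD]] :=
    ex_finite_range_approximation (regprob_nonempty nu0) F D e cY F0 e0.
  have [|nu nuE] := @finite_support_regprob _ _ _
      (distribution nu0 s) (range s) hY fins.
    rewrite /distribution /pushforward -[RHS](measure0 nu0); congr (nu0 _).
    by rewrite -subset0 => y; apply; exists y.
  exists nu; split.
    rewrite nuE// /distribution /pushforward -[RHS](measure0 nu0).
    by congr (nu0 _); rewrite -subset0 => y; exact: sF.
  move=> psi psiD; rewrite (eq_regprob_integral _ _ _ nuE).
  have mpsi : measurable_fun [set: borel_space (regprob_nonempty nu0)] psi.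
    by apply: measurable_fun_borel_continuous; exact: cts_fun.
  have [M psiM] := continuous_compact_bounded _ cY (@cts_fun _ _ psi).
  have ipsi : nu0.-integrable setT (EFin \o psi).
    exact: bounded_integrable mpsi psiM.
  have mpsis : measurable_fun [set: borel_space (regprob_nonempty nu0)]
    (psi \o s) by exact: measurableT_comp.
  have ipsis : nu0.-integrable setT (EFin \o (psi \o s)).
    exact: bounded_integrable mpsis (fun y => psiM (s y)).
  have mdiff := measurable_funB mpsi mpsis.
  have diff_le y : `|psi y - psi (s y)| <= e by rewrite distrC sD.
  (* By change of variables the difference is the integral of [psi - psi \o s], which is at most [e]
     in absolute value. *)
  rewrite /Rintegral integral_distribution//; last exact/measurable_EFinP.
  rewrite -[X in _ - X]/(\int[nu0]_y (psi \o s) y) -RintegralB//.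
  apply: (le_trans (le_normr_Rintegral _ _)) => //.
    exact: bounded_integrable mdiff diff_le.
  apply: (@le_trans _ _ (\int[nu0]_y e)).
    apply: le_Rintegral => //.
    - apply: (@bounded_integrable _ _ _ _ _ e) => [|y].
        exact: measurableT_comp mdiff.
      by rewrite normr_id; exact: diff_le.
    - exact: bounded_integrable (measurable_cst e) (fun=> lexx `|e|).
  by rewrite Rintegral_cst// [fine _](congr1 fine (probability_setT nu0)) mulr1.
have Gnu0 : G --> nu0.
  apply: cvg_initial_topology; apply: cvg_ptws => psi.
  apply/cvgrPdist_le => e e0; exists ([:: psi], e) => //= nu [_].
  by apply; rewrite mem_head.
have : G [set nu : regprob R Y | nu F = 0%E].
  by exists ([::], 1) => [|nu []] /=.
by move=> /(filterI (Gnu0 _ Nnu0))/filter_ex[nu [Nnu nuF]]; exists nu.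
Qed.

(** * Semi-openness of [f] *)

Theorem mainTheorem1 (R : realType) (X Y : topologicalType)
    (cX : compact [set: X]) (hX : hausdorff_space X)
    (cY : compact [set: Y]) (hY : hausdorff_space Y)
    (f : X -> Y) (cf : continuous f) (sf : set_surj [set: X] [set: Y] f) :
  semi_open (pushforward_regprob hY cf : regprob R X -> regprob R Y) ->
  semi_open f.
Proof.
move=> sof U oU [x0 Ux0].
pose X0 : [set: X] !=set0 := ex_intro _ x0 I.
have [phi [cphi phi01 phi0 phi1]] : exists phi : X -> R,
    [/\ continuous phi, forall x, 0 <= phi x <= 1,
        forall x, ~ U x -> phi x = 0 & phi x0 = 1].
  have := normal_completely_regular (compact_normal hX cX)
    (hausdorff_accessible hX).
  move=> /(_ R x0 (~` U) (open_closedC oU) (fun h => h Ux0)).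
  move=> /(@uniform_separatorP _ R)[g [cg g01 gx0 gU]].
  (* The separating function [g] is 0 at [x0] and 1 off [U]. *)
  exists (fun x => 1 - g x); split => [x|x|x Ux|].
  - by apply: cvgB; [exact: cvg_cst|exact: cg].
  - have /g01 : range g (g x) by exists x.
    by rewrite /= in_itv/= => /andP[? ?]; rewrite subr_ge0 gerBl; apply/andP.
  - by rewrite (gU (g x)) ?subrr//; exists x.
  - by rewrite (gx0 (g x0)) ?subr0//; exists x0.
pose phiC : continuousType X R :=
  Continuous.Pack (Continuous.Class (isContinuous.Build _ _ phi cphi)).
have mphi (Z0 : [set: X] !=set0) : measurable_fun [set: borel_space Z0] phi.
  exact: measurable_fun_borel_continuous.
pose W : set (regprob R X) := [set mu : regprob R X | 1 / 2 < \int[mu]_x phi x].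
have oW : open W.
  (* This is [regprob_integral] followed by evaluation at [phiC]. *)
  have cint : continuous (fun mu : regprob R X => \int[mu]_x phi x).
    move=> mu.
    have h1 := @initial_continuous _ _ (@regprob_integral R X) mu.
    exact: (cvg_comp _ _ h1 (@proj_continuous _ _ phiC _)).
  move/continuousP : cint => /(_ [set r | 1 / 2 < r]); apply.
  exact: open_gt.
have [delta Wdelta] : W !=set0.
  pose dx0 := dirac (x0 : borel_space X0) : probability (borel_space X0) R.
  have [|mu muE] := finite_support_regprob dx0 [set x0] hX (finite_set1 x0).
    by rewrite /dx0/= diracE memNset//; apply.
  exists mu; rewrite /W /= (eq_regprob_integral _ _ _ muE) /Rintegral.
  rewrite integral_dirac//; last exact/measurable_EFinP.
  by rewrite diracT mul1e /= phi1 ltr_pdivrMr// mul1r ltr1n.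
have [nu0 nbhs_nu0] := sof W oW (ex_intro _ delta Wdelta).
pose K : set X := [set x | 1 / 2 <= phi x].
have clK : closed K.
  apply: (@closed_comp _ _ phi [set r | 1 / 2 <= r]) => [x _|].
    exact: cphi.
  exact: closed_ge.
have cfK : compact (f @` K).
  apply: continuous_compact; first exact: continuous_subspaceT.
  exact: subclosed_compact clK cX _.
have bfK : borel (f @` K).
  rewrite -[f @` K]setCK.
  apply: (@measurableC _ (borel_space (regprob_nonempty nu0))).
  by apply: sub_sigma_algebra; apply: closed_openC; exact: compact_closed.
(* An interior point of [f @] K[is interior to]f @[U], because [phi] vanishes off [U] and so [K]
   lies in [U]. *)
have [fK0|] := pselect ((f @` K)° = set0); last first.
  move=> /eqP/set0P[y fKy]; exists y; move: fKy; apply: filterS.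
  move=> _ [x Kx <-]; exists x => //; apply: contrapT => /phi0 phix0.
  by move: Kx; rewrite /K /= phix0 leNgt divr_gt0.
have [_ [mu Wmu <-]] := finite_support_null_dense _ _ _ cY hY bfK fK0 nbhs_nu0.
rewrite pushforward_regprobE// => mufK; exfalso.
pose Xmu := borel_space (regprob_nonempty mu).
have bK : borel K.
  rewrite -[K]setCK; apply: (@measurableC _ Xmu).
  by apply: sub_sigma_algebra; exact: closed_openC.
have muK : mu K = 0%E.
  apply/eqP; rewrite eq_le measure_ge0 andbT -mufK.
  apply: (@le_measure _ R Xmu mu); rewrite ?inE//; first exact: borel_preimage.
  by move=> x Kx; exists x.
have iphi : mu.-integrable setT (EFin \o phi).
  apply: (@bounded_integrable _ _ _ _ _ 1) => // x.
  by have /andP[p0 p1] := phi01 x; rewrite ger0_norm.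
move: Wmu; rewrite /W /= ltNge => /negP; apply.
rewrite -lee_fin /Rintegral fineK; last exact: integrable_fin_num.
(* The bound [phi x <= 1 / 2] can fail only on the null set [K]. *)
apply: (@le_trans _ _ (\int[mu]_x (1 / 2)%:E)%E); last first.
  by rewrite integral_cst// [X in (_ * X)%E](probability_setT mu) mule1.
apply: ae_ge0_le_integral => //.
- by move=> x _; rewrite lee_fin; have /andP[] := phi01 x.
- by apply/measurable_EFinP; exact: mphi.
- exists K; split => // x /= nle; rewrite /K /= leNgt; apply/negP => lt.
  by apply: nle => _; rewrite lee_fin ltW.
Qed.
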